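(* The free 2-step nilpotent Lie algebra in three generators $T^*\mathfrak{h}_1$ (the cotangent Lie algebra of the three-dimensional Heisenberg Lie algebra $\mathfrak{h}_1$) admits several (that is, more than one) Kähler structures.
   Context: $T^*\mathfrak{h}_1$ is the six-dimensional real Lie algebra with basis $e_1,\dots,e_6$ and non-zero brackets $[e_1,e_2]=e_3$, $[e_1,e_6]=-e_5$, $[e_2,e_6]=e_4$. A complex structure on a real Lie algebra $\mathfrak{g}$ is a linear map $J$ with $J^2=-\mathrm{I}$ and $[Jx,Jy]-[x,y]-J[Jx,y]-J[x,Jy]=0$ for all $x,y\in\mathfrak{g}$. A symplectic structure is a non-degenerate 2-form $\omega$ with $\omega([x,y],z)+\omega([y,z],x)+\omega([z,x],y)=0$. A Kähler structure on $\mathfrak{g}$ is a pair $(J,\omega)$ of a complex structure and a symplectic structure with $\omega(Jx,Jy)=\omega(x,y)$ for all $x,y$ (no positivity is required). *)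

(* Defs.v *)
(* Mathematical Components; [R : realType] is the field of real numbers. *)
From mathcomp Require Import all_boot all_order all_algebra.
From mathcomp Require Import reals ring.

Set Implicit Arguments.
Unset Strict Implicit.
Unset Printing Implicit Defensive.

Import GRing.Theory.
Local Open Scope ring_scope.

(* A Lie algebra structure on a vector space [V] is given by its bracket. *)
Definition is_lie_bracket (R : realType) (V : vectType R) (br : V -> V -> V) :
    Prop :=
  [/\ bilinear_for *:%R *:%R br,
      forall x, br x x = 0
    & forall x y z, br x (br y z) + br y (br z x) + br z (br x y) = 0].

Definition is_complex_structure (R : realType) (V : vectType R)
    (br : V -> V -> V) (J : 'End(V)) : Prop :=
  (forall x, J (J x) = - x) /\
  (forall x y, br (J x) (J y) - br x y - J (br (J x) y) - J (br x (J y)) = 0).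

Definition is_two_form (R : realType) (V : vectType R) (om : V -> V -> R) :
    Prop :=
  bilinear_for *%R *%R om /\ forall x, om x x = 0.

Definition is_symplectic_structure (R : realType) (V : vectType R)
    (br : V -> V -> V) (om : V -> V -> R) : Prop :=
  [/\ is_two_form om,
      forall x, (forall y, om x y = 0) -> x = 0
    & forall x y z, om (br x y) z + om (br y z) x + om (br z x) y = 0].

Definition is_kahler_structure (R : realType) (V : vectType R)
    (br : V -> V -> V) (K : 'End(V) * (V -> V -> R)) : Prop :=
  [/\ is_complex_structure br K.1,
      is_symplectic_structure br K.2
    & forall x y, K.2 (K.1 x) (K.1 y) = K.2 x y].

(* [th1_basis R i] is e_i for 1 <= i <= 6 (the library counts from 0). *)
Definition th1_basis (R : realType) (i : nat) : 'rV[R]_6 :=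
  delta_mx 0 (inord i.-1).

Definition th1_coord (R : realType) (i : nat) (x : 'rV[R]_6) : R :=
  x 0 (inord i.-1).

(* The bracket of T^*h_1.  Here e_1, e_2, e_3 is the standard basis of h_1,
   and e_4, e_5, e_6 is the dual basis of h_1^*, on which h_1 acts by the
   coadjoint representation; e_1, e_2, e_6 are free 2-step generators. *)
Definition th1_bracket (R : realType) (x y : 'rV[R]_6) : 'rV[R]_6 :=
  let minor (i j : nat) := th1_coord i x * th1_coord j y
                   - th1_coord j x * th1_coord i y in
  minor 1%N 2%N *: th1_basis R 3 - minor 1%N 6%N *: th1_basis R 5
  + minor 2%N 6%N *: th1_basis R 4.

Lemma th1_coord_basis (R : realType) (i j : nat) :
  (0 < i <= 6)%N -> (0 < j <= 6)%N -> th1_coord i (th1_basis R j) =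
    (i == j)%:R.
Proof.
case: i => // i /andP[_ hi]; case: j => // j /andP[_ hj].
by rewrite /th1_coord /th1_basis mxE eqxx -val_eqE /= !inordK // eqSS.
Qed.

Lemma th1_bracket_basis (R : realType) (i j : nat) :
  (0 < i <= 6)%N -> (0 < j <= 6)%N ->
  th1_bracket (th1_basis R i) (th1_basis R j) =
    match i, j with
    | 1, 2 => th1_basis R 3 | 2, 1 => - th1_basis R 3
    | 1, 6 => - th1_basis R 5 | 6, 1 => th1_basis R 5
    | 2, 6 => th1_basis R 4 | 6, 2 => - th1_basis R 4
    | _, _ => 0
    end.
Proof.
move=> hi hj; rewrite /th1_bracket !th1_coord_basis //.
by move: i j hi hj => [|[|[|[|[|[|[|i]]]]]]] [|[|[|[|[|[|[|j]]]]]]] //= _ _;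
  rewrite !(mul0r, mulr0, mul1r, subr0, sub0r, scale0r, scale1r, scaleN1r,
            oppr0, addr0, add0r, opprK).
Qed.

Lemma th1_bracket_lie (R : realType) : is_lie_bracket (@th1_bracket R).
Proof.
split.
- by split=> [z k x y|z k x y]; apply/rowP=> i;
    rewrite /applyr /th1_bracket /th1_coord !mxE; ring.
- by move=> x; apply/rowP=> i; rewrite /th1_bracket /th1_coord !mxE; ring.
- move=> x y z; set b := @th1_bracket R.
  have c0 i u v : i \in [:: 1; 2; 6]%N -> th1_coord i (b u v) = 0.
    have cD p q k l m : th1_coord i
        (k *: th1_basis R 3 - l *: th1_basis R p + m *: th1_basis R q)
      = k * th1_coord i (th1_basis R 3) - l * th1_coord i (th1_basis R p)
        + m * th1_coord i (th1_basis R q).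
      by rewrite /th1_coord !mxE.
    by rewrite !inE => /or3P[] /eqP hi; rewrite cD hi !th1_coord_basis //= !mulr0
      subr0 addr0.
  have bz u v w : b u (b v w) = 0.
    rewrite {1}/b /th1_bracket !c0 //.
    by rewrite !mulr0 subrr !scale0r subrr addr0.
  by rewrite !bz !addr0.
Qed.

(* Main.v *)
(** Write [e^ij] for [e^i /\ e^j].  If [J e_1 = e_2] and [J e_6 = e_3], then
    integrability amounts to [J e_4 = e_5].  A 2-form [om] is closed exactly
    when it vanishes on the centre [<e_3, e_4, e_5>] and
    [om(e_3, e_6) + om(e_4, e_1) + om(e_5, e_2) = 0], so that
    [e^41 + e^52 - 2 e^36 + t e^12] is closed, non-degenerate and
    [J]-invariant for every [t]. *)
Require Import Defs.
From mathcomp Require Import all_boot all_order all_algebra.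
From mathcomp Require Import reals.
From HB Require Import structures.
From mathcomp Require Import ring lra.

Set Implicit Arguments.
Unset Strict Implicit.
Unset Printing Implicit Defensive.

Import GRing.Theory Num.Theory.
Local Open Scope ring_scope.

Section KahlerFamily.

Variable R : realType.
Implicit Types (x y z : 'rV[R]_6) (a t : R).

Lemma th1_coordD i x y : th1_coord i (x + y) = th1_coord i x + th1_coord i y.
Proof. by rewrite /th1_coord mxE. Qed.

Lemma th1_coordN i x : th1_coord i (- x) = - th1_coord i x.
Proof. by rewrite /th1_coord mxE. Qed.

Lemma th1_coordZ i a x : th1_coord i (a *: x) = a * th1_coord i x.
Proof. by rewrite /th1_coord mxE. Qed.

Lemma th1_coord0 i : th1_coord i (0 : 'rV[R]_6) = 0.
Proof. by rewrite /th1_coord mxE. Qed.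

Lemma th1_coordP x y :
  [/\ th1_coord 1 x = th1_coord 1 y, th1_coord 2 x = th1_coord 2 y
    & th1_coord 3 x = th1_coord 3 y] ->
  [/\ th1_coord 4 x = th1_coord 4 y, th1_coord 5 x = th1_coord 5 y
    & th1_coord 6 x = th1_coord 6 y] -> x = y.
Proof.
move=> [h1 h2 h3] [h4 h5 h6]; apply/rowP => i.
(* With [i] written as [inord k], the entry at [i] is [th1_coord k.+1] by conversion, so each case
   is one of the hypotheses. *)
rewrite -[i]inord_val.
by case: i => [[|[|[|[|[|[|//]]]]]] /= _].
Qed.

Definition th1_J_fun x : 'rV[R]_6 :=
  - th1_coord 2 x *: th1_basis R 1 + th1_coord 1 x *: th1_basis R 2
  + th1_coord 6 x *: th1_basis R 3 - th1_coord 5 x *: th1_basis R 4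
  + th1_coord 4 x *: th1_basis R 5 - th1_coord 3 x *: th1_basis R 6.

Lemma th1_J_fun_is_linear : linear th1_J_fun.
Proof.
move=> a x y; apply/rowP => i.
by rewrite /th1_J_fun !th1_coordD !th1_coordZ !mxE; ring.
Qed.

HB.instance Definition _ :=
  GRing.isLinear.Build R _ _ _ th1_J_fun th1_J_fun_is_linear.

Definition th1_J : 'End('rV[R]_6) := linfun th1_J_fun.

Lemma th1_coord_J x :
  [/\ th1_coord 1 (th1_J x) = - th1_coord 2 x,
      th1_coord 2 (th1_J x) = th1_coord 1 x
    & th1_coord 3 (th1_J x) = th1_coord 6 x] /\
  [/\ th1_coord 4 (th1_J x) = - th1_coord 5 x,
      th1_coord 5 (th1_J x) = th1_coord 4 x
    & th1_coord 6 (th1_J x) = - th1_coord 3 x].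
Proof.
rewrite lfunE /= /th1_J_fun !(th1_coordD, th1_coordN, th1_coordZ).
by rewrite !th1_coord_basis //=; split; split; ring.
Qed.

Definition th1_minor (i j : nat) x y : R :=
  th1_coord i x * th1_coord j y - th1_coord j x * th1_coord i y.

Arguments th1_minor (i j)%_N x y.

Lemma th1_coord_bracket x y :
  [/\ th1_coord 1 (th1_bracket x y) = 0,
      th1_coord 2 (th1_bracket x y) = 0
    & th1_coord 3 (th1_bracket x y) = th1_minor 1 2 x y] /\
  [/\ th1_coord 4 (th1_bracket x y) = th1_minor 2 6 x y,
      th1_coord 5 (th1_bracket x y) = - th1_minor 1 6 x y
    & th1_coord 6 (th1_bracket x y) = 0].
Proof.
rewrite /th1_minor /th1_bracket !(th1_coordD, th1_coordN, th1_coordZ).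
by rewrite !th1_coord_basis //=; split; split; ring.
Qed.

(** Repacked as a tuple, the six equations act as one multi-rewrite rule. *)
Let coordJ x := (let: conj (And3 h1 h2 h3) (And3 h4 h5 h6) := th1_coord_J x in
  (h1, h2, h3, h4, h5, h6)).

Let coordB x y :=
  (let: conj (And3 h1 h2 h3) (And3 h4 h5 h6) := th1_coord_bracket x y in
  (h1, h2, h3, h4, h5, h6)).

Let minorE i j x y : th1_minor i j x y =
  th1_coord i x * th1_coord j y - th1_coord j x * th1_coord i y.
Proof. by []. Qed.

Let coordE := (minorE, th1_coordD, th1_coordN, th1_coordZ, th1_coord0,
  coordJ, coordB).

(** The Nijenhuis tensor N is alternating and N(Jx, y) = - J N(x, y), so pairs from e_1, e_4, e_6
    decide. As e_3, e_4, e_5 are central, the only one to check is N(e_1, e_6) = e_5 - J e_4 = 0. *)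
Lemma th1_J_complex : is_complex_structure (@th1_bracket R) th1_J.
Proof.
split=> [x|x y]; apply: th1_coordP; split; rewrite !coordE; ring.
Qed.

(** Invariance under J forces equal coefficients on e^41 and e^52; closedness then fixes the -2. The
    term in e^12 affects neither condition. *)
Definition th1_form t x y : R :=
  th1_minor 4 1 x y + th1_minor 5 2 x y - 2 * th1_minor 3 6 x y
  + t * th1_minor 1 2 x y.

Lemma th1_form_symplectic t :
  is_symplectic_structure (@th1_bracket R) (th1_form t).
Proof.
split.
- split; last by move=> x; rewrite /th1_form /th1_minor; ring.
  by split=> [z a x y|z a x y]; rewrite /applyr /= /th1_form !coordE; ring.
- move=> x hx.
  have := (hx (th1_basis R 1), hx (th1_basis R 2), hx (th1_basis R 3),
           hx (th1_basis R 4), hx (th1_basis R 5), hx (th1_basis R 6)).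
  rewrite /th1_form /th1_minor !th1_coord_basis //=.
  move=> [[[[[h1 h2] h3] h4] h5] h6].
  have x1 : th1_coord 1 x = 0 by lra.
  have x2 : th1_coord 2 x = 0 by lra.
  (* Pairing with e_1 and e_2 gives x_4 - t x_2 and x_5 + t x_1; the substitution removes the
     products with [t], which are not linear. *)
  rewrite x1 x2 in h1 h2.
  by apply: th1_coordP; split; rewrite th1_coord0; lra.
- by move=> x y z; rewrite /th1_form !coordE; ring.
Qed.

(** Pulling back by J exchanges e^41 and e^52 and fixes e^36 and e^12. *)
Lemma th1_kahler t :
  is_kahler_structure (@th1_bracket R) (th1_J, th1_form t).
Proof.
split; [exact: th1_J_complex | exact: th1_form_symplectic |].
by move=> x y; rewrite /= /th1_form !coordE; ring.
Qed.

Lemma th1_form_inj : injective th1_form.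
Proof.
(* The value at (e_1, e_2) is the parameter itself. *)
move=> s t /(congr1 (fun om => om (th1_basis R 1) (th1_basis R 2))).
by rewrite /th1_form /th1_minor !th1_coord_basis //=; lra.
Qed.

End KahlerFamily.

Theorem lemma5p12 (R : realType) :
  exists K K' : 'End('rV[R]_6) * ('rV[R]_6 -> 'rV[R]_6 -> R),
    [/\ is_kahler_structure (@th1_bracket R) K,
        is_kahler_structure (@th1_bracket R) K'
      & K <> K'].
Proof.
exists (th1_J R, th1_form 0), (th1_J R, th1_form 1).
split; [exact: th1_kahler | exact: th1_kahler |].
by case=> /th1_form_inj /eqP; rewrite eq_sym oner_eq0.
Qed.
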